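(* Let $P$ be a register machine program using only one register, with one read statement at the beginning and one write statement at the end, and let $f$ be the (possibly partial) function from integers to integers that it computes. Then $f$ is automatic, and there are integer constants $k,h,i,j,i',j'$ with $k,h>0$ and $i,i'$ powers of $2$ such that: (1) either $f(x)=f(x+h)$ for all $x\geq k$, or $f(x)=ix+j$ for all $x\geq k$, or $f(x)=-ix+j$ for all $x\geq k$; (2) either $f(x)=f(x-h)$ for all $x\leq -k$, or $f(x)=i'x+j'$ for all $x\leq -k$, or $f(x)=-i'x+j'$ for all $x\leq -k$. Here $f(x)=f(x+h)$ means that either $f$ is undefined on both arguments or both values are defined and equal. In the second and third alternatives of each item the computation time is constant; in the first alternative it is either constant, or exponential in the number $n$ of binary digits of $x$, or the computation does not terminate.
   Context: Model (addition machine): finitely many registers holding arbitrary integers; unit-cost commands $x=y+z$, $x=y+c$, $x=y-z$, $x=y-c$, $x=c-y$, $x=c$ (registers $x,y,z$, integer constants $c$), read/write of a whole integer, conditionals comparing a register with a register or a constant via $<,=,>,\neq,\leq,\geq$, and goto; finitely many variables with a fixed finite range of values may also be used and do not count as registers. The function computed maps the input read to the output written; it is undefined where the program does not halt. A function $f$ on numbers is automatic if for some base $b\geq 2$ there is a deterministic finite automaton which reads the base-$b$ representation of $x$ and of a candidate $y$ in parallel symbol by symbol (padded with leading zeros, aligned at the least significant digit; signs encoded by an extra symbol) and accepts exactly when $y=f(x)$. *)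

(* Defs.v *)
From HB Require Import structures.
From mathcomp Require Import all_boot all_order all_algebra.
Set Implicit Arguments.
Unset Strict Implicit.
Unset Printing Implicit Defensive.
Import Order.TTheory GRing.Theory Num.Theory.
Local Open Scope ring_scope.

(** * Addition machines *)

Inductive cmp := CLt | CEq | CGt | CNe | CLe | CGe.

Definition cmp_eval (o : cmp) (a b : int) : bool :=
  match o with
  | CLt => a < b
  | CEq => a == b
  | CGt => b < a
  | CNe => a != b
  | CLe => a <= b
  | CGe => b <= a
  end.

(** [r] is the number of registers, [n] the number of lines of the program, and
    [V] the set of joint values of all the finite-range variables; a constant
    operand [c : V -> int] is either a literal integer (a constant function) or
    the value of an integer-valued finite-range variable. *)
Inductive instr (r n : nat) (V : Type) :=
  | IRead of 'I_r
  | IWrite of 'I_r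
  | IAdd of 'I_r & 'I_r & 'I_r               (* x = y + z *)
  | IAddC of 'I_r & 'I_r & (V -> int)        (* x = y + c *)
  | ISub of 'I_r & 'I_r & 'I_r               (* x = y - z *)
  | ISubC of 'I_r & 'I_r & (V -> int)        (* x = y - c *)
  | ICSub of 'I_r & (V -> int) & 'I_r        (* x = c - y *)
  | IConst of 'I_r & (V -> int)              (* x = c *)
  | IIf of 'I_r & cmp & 'I_r & 'I_n          (* if x o y then goto l *)
  | IIfC of 'I_r & cmp & (V -> int) & 'I_n   (* if x o c then goto l *)
  | IGoto of 'I_n
  | IVar of (V -> V)                         (* update the finite variables *)
  | IIfVar of pred V & 'I_n.                 (* branch on the finite variables *)

Record program (r : nat) := Program {
  len : nat;
  fvars : finType;
  fvars0 : fvars;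
  code : 'I_len -> instr r len fvars }.

(** Jump targets are lines of the program, so the only way to halt, i.e. to
    reach [pc = None], is to fall off the last line. *)
Record config (r : nat) (P : program r) := Config {
  pc : option 'I_(len P);
  regs : {ffun 'I_r -> int};
  vars : fvars P;
  input : seq int;
  output : seq int }.

Definition init_config (r : nat) (P : program r) (inp : seq int) : config P :=
  Config (insub 0%N) [ffun=> 0] (fvars0 P) inp [::].

Section Semantics.

Variables (r : nat) (P : program r).
Implicit Types (c : config P) (l : 'I_(len P)).

Definition jump l c : config P :=
  Config (Some l) (regs c) (vars c) (input c) (output c).

Definition next l c : config P :=
  Config (insub l.+1) (regs c) (vars c) (input c) (output c).

Definition set_reg (x : 'I_r) (a : int) c : config P :=
  Config (pc c) [ffun y => if y == x then a else regs c y]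
         (vars c) (input c) (output c).

(** A read statement with no input left blocks forever. *)
Definition exec l c : config P :=
  match code l with
  | IRead x =>
      if input c is a :: s then
        next l (set_reg x a (Config (pc c) (regs c) (vars c) s (output c)))
      else c
  | IWrite x =>
      next l (Config (pc c) (regs c) (vars c) (input c)
                     (rcons (output c) (regs c x)))
  | IAdd x y z => next l (set_reg x (regs c y + regs c z) c)
  | IAddC x y k => next l (set_reg x (regs c y + k (vars c)) c)
  | ISub x y z => next l (set_reg x (regs c y - regs c z) c)
  | ISubC x y k => next l (set_reg x (regs c y - k (vars c)) c)
  | ICSub x k y => next l (set_reg x (k (vars c) - regs c y) c)
  | IConst x k => next l (set_reg x (k (vars c)) c)
  | IIf x o y l' =>
      if cmp_eval o (regs c x) (regs c y) then jump l' c else next l c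
  | IIfC x o k l' =>
      if cmp_eval o (regs c x) (k (vars c)) then jump l' c else next l c
  | IGoto l' => jump l' c
  | IVar g => next l (Config (pc c) (regs c) (g (vars c)) (input c) (output c))
  | IIfVar p l' => if p (vars c) then jump l' c else next l c
  end.

Definition step c : config P := if pc c is Some l then exec l c else c.

Definition run (t : nat) (x : int) : config P :=
  iter t step (init_config P [:: x]).

(** On input [x] the program halts after executing exactly [t] commands. *)
Definition halts_in (x : int) (t : nat) : Prop :=
  pc (run t x) = None /\ forall s, (s < t)%N -> pc (run s x) <> None.

Definition computes (f : int -> option int) : Prop :=
  forall x y, f x = Some y <->
    exists t, halts_in x t /\ output (run t x) = [:: y].

Definition is_read n V (s : instr r n V) : bool :=
  if s is IRead _ then true else false.

Definition is_write n V (s : instr r n V) : bool :=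
  if s is IWrite _ then true else false.

(** One read statement, on the first line, and one write statement, on the
    last line. *)
Definition read_first_write_last : Prop :=
  (0 < len P)%N /\
  forall l, is_read (code l) = (l == 0%N :> nat) /\
            is_write (code l) = (l.+1 == len P :> nat).

End Semantics.

(** * Automatic functions *)

Record dfa (S : finType) := Dfa {
  dstate : finType;
  dstart : dstate;
  dstep : dstate -> S -> dstate;
  dfinal : pred dstate }.

Definition dfa_accepts (S : finType) (A : dfa S) (w : seq S) : bool :=
  dfinal (foldl (@dstep S A) (dstart A) w).

(** Number of base-[b] digits of [n], for [1 < b]; it is 1 for [n = 0]. *)
Definition ndigits (b n : nat) : nat := (trunc_log b n).+1.

(** The base is [b.+2], so that it ranges over all integers that are at least 2.
    A symbol is a sign ([inl true] for minus, [inl false] for plus) or a digit. *)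
Definition sym (b : nat) : finType := (bool + 'I_b.+2)%type.

(** Sign, then [L] digits of the absolute value, most significant first. *)
Definition repr (b L : nat) (x : int) : seq (sym b) :=
  inl (x < 0) ::
  [seq inr (inZp (`|x|%N %/ b.+2 ^ i)) | i <- rev (iota 0 L)].

Definition conv (b : nat) (x y : int) : seq (sym b * sym b)%type :=
  let L := maxn (ndigits b.+2 `|x|%N) (ndigits b.+2 `|y|%N) in
  zip (repr b L x) (repr b L y).

Definition automatic (f : int -> option int) : Prop :=
  exists (b : nat) (A : dfa (sym b * sym b)%type),
    forall x y, dfa_accepts A (conv b x y) <-> f x = Some y.

(** * Computation time *)

Definition constant_time (r : nat) (P : program r) (D : int -> Prop) : Prop :=
  exists t, forall x, D x -> halts_in P x t.

(** Exponential means [2 ^ Theta(n)], [n] being the number of binary digits of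
    the input; inputs of [D] on which the program terminates and inputs of [D]
    on which it does not may coexist. *)
Definition exponential_time_or_diverges
    (r : nat) (P : program r) (D : int -> Prop) : Prop :=
  exists a b c d : rat, [/\ 1 < a, 1 < b, 0 < c & 0 < d] /\
    forall x, D x ->
      (exists t, halts_in P x t /\
         c * a ^+ ndigits 2 `|x|%N <= t%:R <= d * b ^+ ndigits 2 `|x|%N)
      \/ ~ (exists t, halts_in P x t).

Definition power_of_2 (i : int) : Prop := exists m : nat, i = 2 ^+ m.

(* Main.v *)
Require Import Defs.
From mathcomp Require Import all_boot all_order all_algebra.
From mathcomp Require Import zify ring.
From Stdlib Require Import Classical.
Import Order.TTheory GRing.Theory Num.Theory.
Local Open Scope ring_scope.

Set Implicit Arguments.
Unset Strict Implicit.
Unset Printing Implicit Defensive.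

(** As long as the register is larger in absolute value than all constants the
    program compares it with, the control flow depends only on its sign, and
    the register is an affine function of the input with slope 0 or plus or
    minus a power of 2.  The control flow on large inputs is therefore
    eventually periodic unless the program halts, which gives the affine case,
    or resets the register, which makes the outcome independent of the input.
    Over one period the register changes by an affine map of slope a power of
    2; if it does not decrease in absolute value the program diverges, and
    otherwise it decreases by a fixed amount [h].  It is then counted down to a
    bounded range, so that the outcome depends on the input modulo [h] only and
    the time is linear in the input, i.e. exponential in its number of digits.

    Graphs of such functions are Boolean combinations of linear equations,
    congruences and sign conditions, each recognised by an automaton reading
    binary digits from the most significant one. *)

(** * Large register values *)

Section FirstHit.

Variables (T : Type) (G : T -> T) (H : pred T).
Implicit Types (c d e : T) (n m t : nat).

(** The endpoint is left unconstrained, so that a first hit is a path whose end lies in [H]. *)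
Definition avoids n c d : Prop :=
  iter n G c = d /\ forall i, (i < n)%N -> ~~ H (iter i G c).

Definition hits c t d : Prop := avoids t c d /\ H d.

Lemma avoids_trans n m c d e :
  avoids n c d -> avoids m d e -> avoids (n + m) c e.
Proof.
move=> [cd Hc] [de Hd]; split=> [|i lt_i]; first by rewrite addnC iterD cd.
have [/Hc //|le_ni] := ltnP i n.
by rewrite -(subnK le_ni) iterD cd Hd // ltn_subLR.
Qed.

Lemma hits_shift n c d t e : avoids n c d -> hits d t e <-> hits c (n + t) e.
Proof.
move=> cd; split=> [[de He]|[[ce Hc] He]]; first by split=> //; apply: avoids_trans de.
have [cd1 _] := cd; split=> //; split=> [|i lt_i].
  by rewrite -cd1 -iterD addnC.
by rewrite -cd1 -iterD addnC Hc // ltn_add2l.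
Qed.

Lemma avoids_leq n c d t e : avoids n c d -> hits c t e -> (n <= t)%N.
Proof.
move=> [_ Hc] [[ce _] He]; rewrite leqNgt; apply/negP => /Hc.
by rewrite ce He.
Qed.

End FirstHit.

Section LargeArguments.

Variables (Q : finType) (H : pred Q) (G : Q * int -> Q * int).
Variables (nxt : Q -> Q) (al : Q -> nat) (be : Q -> int) (C : int).
Hypothesis G_large :
  forall q z, C < z -> G (q, z) = (nxt q, (al q)%:Z * z + be q).
Hypothesis al_pow2 : forall q, al q = 0%N \/ exists m, al q = (2 ^ m)%N.

Let Hc : pred (Q * int) := fun c => H c.1.

Fixpoint slope q n : nat :=
  if n is m.+1 then (al (iter m nxt q) * slope q m)%N else 1%N.

Fixpoint offset q n : int :=
  if n is m.+1 then (al (iter m nxt q))%:Z * offset q m + be (iter m nxt q)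
  else 0.

Definition live q := ~~ H q && (al q != 0)%N.

Lemma slope_pow2 q n :
  (forall i, (i < n)%N -> live (iter i nxt q)) ->
  exists m, slope q n = (2 ^ m)%N.
Proof.
elim: n => [|n IHn] lv /=; first by exists 0%N.
have [i lt_i|m ->] := IHn; first by apply: lv; apply: ltnW.
have /andP[_ /eqP nz] := lv n (ltnSn n).
have [//|[m' ->]] := al_pow2 (iter n nxt q).
by exists (m' + m)%N; rewrite expnD.
Qed.

Lemma slope_gt0 q n :
  (forall i, (i < n)%N -> live (iter i nxt q)) -> (0 < slope q n)%N.
Proof. by move=> /slope_pow2[m ->]; rewrite expn_gt0. Qed.

(* The control path of a large argument depends on the state alone; the last
   state of the path may be one that assigns a constant. *)
Lemma avoids_large q n :
  (forall i, (i < n)%N -> live (iter i nxt q)) ->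
  exists K, forall z, K < z ->
    avoids G Hc n (q, z) (iter n nxt q, (slope q n)%:Z * z + offset q n) /\
    C < (slope q n)%:Z * z + offset q n.
Proof.
elim: n => [|n IHn] lv.
  by exists C => z Cz; split; [split=> //=; congr pair; ring | rewrite /=; lia].
have lv' i (lt_i : (i < n)%N) := lv i (ltnW lt_i).
have [K KP] := IHn lv'.
have sl := slope_gt0 lv.
exists (`|K| + `|C| + `|offset q n.+1|) => z ltz; split; last by nia.
have [av lt] := KP z ltac:(lia).
rewrite -addn1; apply: avoids_trans av _.
split=> [|[|//] _] /=; last by have /andP[] := lv n (ltnSn n).
by rewrite G_large // addn1 /=; congr pair; rewrite PoszM; ring.
Qed.

(** The last state may reset the register, so, unlike in [avoids_large], the value reached need not
    exceed [C]. *)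
Lemma avoids_large_step q n :
  (forall i, (i < n)%N -> live (iter i nxt q)) -> ~~ H (iter n nxt q) ->
  exists K, forall z, K < z ->
    avoids G Hc n.+1 (q, z)
      (iter n.+1 nxt q, (slope q n.+1)%:Z * z + offset q n.+1).
Proof.
move=> lv nH; have [K KP] := avoids_large lv.
exists K => z /KP[av lt]; rewrite -addn1; apply: avoids_trans av _.
split=> [|[|//] _] //=.
by rewrite G_large // addn1 /=; congr pair; rewrite PoszM; ring.
Qed.

Lemma iter_eventually_periodic (q : Q) :
  exists p c, (0 < c)%N /\ iter c nxt (iter p nxt q) = iter p nxt q.
Proof.
have /trajectP[i lt_i eq_i] := looping_order nxt q.
exists i, (fingraph.order nxt q - i)%N; rewrite subn_gt0; split=> //.
by rewrite -iterD subnK // ltnW.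
Qed.

(** A hit at time [t] is impossible because [t + 1] turns of the cycle take more than [t] steps and
    never meet [H]. *)
Lemma nondecreasing_cycle_diverges q c K :
  (0 < c)%N ->
  (forall z, K < z -> exists2 z', z <= z' & avoids G Hc c (q, z) (q, z')) ->
  forall z t d, K < z -> ~ hits G Hc (q, z) t d.
Proof.
move=> c0 av z t d Kz hit.
have /(_ t.+1)[z' le_z av'] : forall n,
    exists2 z', z <= z' & avoids G Hc (n * c) (q, z) (q, z').
  elim=> [|n [z' le_z av1]]; first by exists z.
  have [z2 le2 av2] := av z' (lt_le_trans Kz le_z).
  exists z2; first exact: le_trans le2.
  by rewrite mulSn addnC; apply: avoids_trans av1 av2.
have := avoids_leq av' hit; nia.
Qed.

(** At the start of each turn the register is still at least [z], hence above [K]. *)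
Lemma decreasing_cycle_avoids q c K h :
  (forall z, K < z -> avoids G Hc c (q, z) (q, z - h)) -> 0 <= h ->
  forall n z, K < z -> avoids G Hc (n * c) (q, z + n%:Z * h) (q, z).
Proof.
move=> av h0 n z Kz; elim: n => [|n IHn]; first by rewrite mul0r addr0.
rewrite mulSn; apply: avoids_trans IHn.
have -> : z + n%:Z * h = z + n.+1%:Z * h - h by rewrite intS; ring.
by apply: av; nia.
Qed.

(* Past the threshold the computation halts, resets the register, or runs
   into a cycle of control states; in a cycle the register either never
   decreases or counts down by a fixed amount. *)
Lemma large_trichotomy q :
  exists k : nat,
    [\/ exists t m j q', forall z : int, k%:Z <= z ->
          hits G Hc (q, z) t (q', (2 ^ m)%N%:Z * z + j),
        exists t d, forall z : int, k%:Z <= z -> hits G Hc (q, z) t d,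
        forall z : int, k%:Z <= z -> forall t d, ~ hits G Hc (q, z) t d
      | exists h e : nat, [/\ (0 < h)%N, (0 < e)%N &
          forall z : int, k%:Z <= z -> forall t d,
            hits G Hc (q, z + h%:Z) t d <->
            exists2 t', t = (t' + e)%N & hits G Hc (q, z) t' d]].
Proof.
have [[t0 Ht0]|nolive] := classic (exists t, ~~ live (iter t nxt q)).
  (* [t] is the first time on the control path at which the program has halted or resets the
     register. *)
  have [t nlt tmin] := ex_minnP (ex_intro (fun t => ~~ live (iter t nxt q)) _ Ht0).
  have lv i : (i < t)%N -> live (iter i nxt q).
    by apply: contraTT => /tmin; rewrite leqNgt.
  case: (boolP (H (iter t nxt q))) => [Ht|nHt].
    have [K KP] := avoids_large lv; have [m mE] := slope_pow2 lv.
    exists `|K|.+1; constructor 1.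
    exists t, m, (offset q t), (iter t nxt q) => z le_z.
    by rewrite -mE; split=> //; have [] := KP z ltac:(lia).
  have [K KP] := avoids_large_step lv nHt.
  have al0 : slope q t.+1 = 0%N.
    by move: nlt; rewrite /live nHt negbK /= => /eqP ->; rewrite mul0n.
  rewrite al0 in KP.
  pose d0 := (iter t.+1 nxt q, offset q t.+1).
  have {}KP z : K < z -> avoids G Hc t.+1 (q, z) d0.
    by move=> /KP; rewrite mul0r add0r.
  exists `|K|.+1.
  (* After the reset the configuration is [d0] whatever [z] was, so all large [z] share one
     outcome. *)
  have [[u [d hit]]|nhit] := classic (exists u d, hits G Hc d0 u d).
    constructor 2; exists (t.+1 + u)%N, d => z le_z.
    by apply/(hits_shift _ _ (KP z ltac:(lia))).
  constructor 3 => z le_z u d hit; apply: nhit.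
  have av := KP z ltac:(lia).
  exists (u - t.+1)%N, d; apply/(hits_shift _ _ av).
  by rewrite subnKC // (avoids_leq av hit).
have lv i : live (iter i nxt q) by apply/negP => /negP ?; apply: nolive; exists i.
have [p [c [c0 qc]]] := iter_eventually_periodic q.
set q1 := iter p nxt q in qc.
have lv1 i : live (iter i nxt q1) by rewrite /q1 -iterD.
have [K KP] := avoids_large (fun i (_ : (i < p)%N) => lv i).
have [L LP] := avoids_large (fun i (_ : (i < c)%N) => lv1 i).
have sp := slope_gt0 (fun i (_ : (i < p)%N) => lv i).
have sc := slope_gt0 (fun i (_ : (i < c)%N) => lv1 i).
rewrite qc -/q1 in KP LP.
set a := slope q1 c in LP sc; set b := offset q1 c in LP.
set a' := slope q p in KP sp; set b' := offset q p in KP.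
(* In the growing case [w <= a * w + b] for [w] beyond [|b|]; otherwise [a = 1] and [b < 0]. *)
have [grows|/norP[a1 b0]] := boolP ((1 < a)%N || (0 <= b)).
  exists (`|K| + `|L| + `|b| + `|b'|).+1; constructor 3 => z le_z t d hit.
  have [av _] := KP z ltac:(lia).
  have le_pt := avoids_leq av hit.
  move: hit; rewrite -(subnKC le_pt) => /(hits_shift _ _ av).
  apply: (@nondecreasing_cycle_diverges q1 c (`|L| + `|b|)) => //; last by nia.
  move=> w lt_w; have [av1 _] := LP w ltac:(lia).
  by exists (a%:Z * w + b) => //; case/orP: grows => ?; nia.
have {}a1 : a = 1%N by lia.
have down w : L < w -> avoids G Hc c (q1, w) (q1, w - `|b|%N%:Z).
  move=> /LP[]; rewrite a1 mul1r.
  by have -> : w + b = w - `|b|%N%:Z by lia.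
exists (`|K| + `|L| + `|b'|).+1; constructor 4.
(* The prefix scales by [a']: raising [z] by [|b|] raises the register at [q1] by [a' * |b|], which
   [a'] turns of [c] steps each remove. *)
exists `|b|%N, (a' * c)%N; split; [lia | nia |] => z le_z t d.
have [av _] := KP z ltac:(lia).
have [avh _] := KP (z + `|b|%N%:Z) ltac:(lia).
have := @decreasing_cycle_avoids q1 c L `|b|%N%:Z down
  ltac:(lia) a' (a'%:Z * z + b') ltac:(nia).
have -> : a'%:Z * z + b' + a'%:Z * `|b|%N%:Z = a'%:Z * (z + `|b|%N%:Z) + b' by ring.
(* The runs from [z + |b|] and from [z] both pass through [(q1, a' * z + b')], after [p + a' * c]
   and [p] steps. *)
move=> avc; have avhc := avoids_trans avh avc.
split=> [hit|[t' -> hit]].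
  have le_t := avoids_leq avhc hit.
  exists (p + (t - (p + a' * c)))%N; first by lia.
  apply/(hits_shift _ _ av); apply/(hits_shift _ _ avhc).
  by rewrite subnKC.
have le_t := avoids_leq av hit.
have -> : (t' + a' * c = p + a' * c + (t' - p))%N by lia.
apply/(hits_shift _ _ avhc); apply/(hits_shift _ _ av).
by rewrite subnKC.
Qed.

End LargeArguments.

(** * Simulation of one-register programs *)

Definition sg (s : bool) : int := if s then - 1 else 1.

Lemma sgK s : involutive ( *%R (sg s)).
Proof. by case: s => z /=; rewrite ?mulN1r ?mul1r ?opprK. Qed.

Lemma sg_flip s (a z : int) : sg (s (+) (a < 0)) * (a * (sg s * z)) = `|a| * z.
Proof.
by case: ltrP => a0; [rewrite ltr0_norm|rewrite ger0_norm] => //;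
   case: s; rewrite /sg /=; ring.
Qed.

Section OneRegister.

Variable P : program 1.

Definition returns (x : int) (t : nat) (y : int) : Prop :=
  halts_in P x t /\ output (run P t x) = [:: y].

Lemma halts_in_inj x t t' : halts_in P x t -> halts_in P x t' -> t = t'.
Proof.
move=> [Ht mint] [Ht' mint']; case: (ltngtP t t') => // lt; first by case: (mint' _ lt).
by case: (mint _ lt).
Qed.

(* Control states carry, besides the line and the finite variables, a sign
   [s] such that the register holds [sg s * z]: negating the register flips
   [s], so that all slopes in [z] are nonnegative and both signs of the input
   are covered by the analysis of large positive [z]. *)
Definition control : finType := (option 'I_(len P) * fvars P * bool)%type.

(** With a single register both operands are that register: addition doubles it and subtraction
    clears it. *)
Definition effect (n : nat) (V : Type) (i : instr 1 n V) (v : V) : int * int :=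
  match i with
  | IAdd _ _ _ => (2, 0)
  | IAddC _ _ k => (1, k v)
  | ISub _ _ _ => (0, 0)
  | ISubC _ _ k => (1, - k v)
  | ICSub _ k _ => (- 1, k v)
  | IConst _ k => (0, k v)
  | _ => (1, 0)
  end.

(** The input is consumed before the simulation starts, so a further read blocks on its line. *)
Definition target (l : 'I_(len P)) (v : fvars P) (x : int) :
    option 'I_(len P) * fvars P :=
  match code l with
  | IRead _ => (Some l, v)
  | IIf _ o _ l' => (if cmp_eval o x x then Some l' else insub l.+1, v)
  | IIfC _ o k l' => (if cmp_eval o x (k v) then Some l' else insub l.+1, v)
  | IGoto l' => (Some l', v)
  | IVar g => (insub l.+1, g v)
  | IIfVar p l' => (if p v then Some l' else insub l.+1, v)
  | _ => (insub l.+1, v)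
  end.

Definition abs_step (c : control * int) : control * int :=
  let: ((o, v), s, z) := c in
  if o is Some l then
    let: (a, b) := effect (code l) v in
    let s' := s (+) (a < 0) in
    (target l v (sg s * z), s', sg s' * (a * (sg s * z) + b))
  else c.

Definition halted : pred control := fun q => ~~ isSome q.1.1.

(** Halting is possible only through the final write, hence the output is empty until then and holds
    the register afterwards. *)
Definition sim (c : config P) (d : control * int) : Prop :=
  [/\ (pc c, vars c) = d.1.1, regs c ord0 = sg d.1.2 * d.2, input c = [::]
    & output c = if pc c is Some _ then [::] else [:: regs c ord0]].

Hypothesis hP : read_first_write_last P.

Lemma insub_next (l : 'I_(len P)) :
  isSome (insub l.+1 : option 'I_(len P)) = ~~ is_write (code l).
Proof.
rewrite isSome_insub; have [_ /(_ l)[_ ->]] := hP.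
by rewrite ltn_neqAle ltn_ord andbT.
Qed.

Lemma sim_step c d : sim c d -> sim (step c) (abs_step d).
Proof.
case: d => [[[o v] s] z]; case: c => [o' rg v' inp out] [/= [-> ->] rgE -> ->].
case: o => [l|]; last by rewrite /step /abs_step /=.
rewrite /step /abs_step /exec /target /sim /Defs.next /=.
have rg1 i : rg i = sg s * z by rewrite (ord1 i).
have := insub_next l.
by case: (code l) => [x|x|x y y'|x y k|x y y'|x y k|x k y|x k|x o y l'|x o k l'|l'|g|p l'] /=;
   rewrite ?ltxx ?oppr_lt0 ?ltr01 ?ltr10 ?addbT ?addbF ?sgK ?ffunE ?rg1 ?ord1 ?eqxx //=;
   case: (insub l.+1) => [l2|] // _; try case: ifP => _;
   rewrite /= ?rg1; split=> //; ring.
Qed.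

(** This is the state after the initial read, with the input already in the register; simulated time
    therefore lags by one. *)
Definition start (s : bool) : control := (insub 1%N, fvars0 P, s).

Lemma sim_start s z : sim (run P 1 (sg s * z)) (start s, z).
Proof.
have [len0 rw] := hP.
rewrite /run /= /init_config /step /= insubT /=.
have [rd wr] := rw (Ordinal len0); have nx := insub_next (Ordinal len0).
move: rd wr nx; rewrite /exec /=; case: (code _) => //= x _ _.
rewrite /start /sim /=; case: (insub 1%N) => [l2|] // _.
by rewrite /= ffunE (ord1 x) eqxx.
Qed.

Lemma sim_run s z t :
  sim (run P t.+1 (sg s * z)) (iter t abs_step (start s, z)).
Proof.
elim: t => [|t IHt]; first exact: sim_start.
by rewrite /run !iterS; apply: sim_step.
Qed.

Lemma pc_run0 x : pc (run P 0 x) <> None.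
Proof. by have [len0 _] := hP; rewrite /run /init_config /= insubT. Qed.

Lemma sim_halted c d : sim c d -> pc c = None <-> halted d.1.
Proof. by rewrite /halted => -[<- _ _ _] /=; case: (pc c). Qed.

Lemma returnsP s z t y :
  returns (sg s * z) t y <->
  exists t' d, [/\ t = t'.+1, hits abs_step (fun c => halted c.1) (start s, z) t' d
                 & y = sg d.1.2 * d.2].
Proof.
split=> [[[Ht mint] yE]|[t' [d [-> [[dE mint] Hd] ->]]]].
  case: t Ht mint yE => [/pc_run0 //|t] Ht mint yE.
  exists t, (iter t abs_step (start s, z)).
  have sm := sim_run s z t; split=> //.
    split; last by apply/(sim_halted sm).
    split=> // i lt_i; apply/negP => /(sim_halted (sim_run s z i)).
    exact: mint.
  by case: sm yE => _ <- _ ->; rewrite Ht => -[].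
have sm := sim_run s z t'; rewrite dE in sm.
have Ht := (sim_halted sm).2 Hd; split; last by case: sm => _ <- _ ->; rewrite Ht.
split=> // -[|i] lt_i; first exact: pc_run0.
by move=> /(sim_halted (sim_run s z i)); apply/negP/mint.
Qed.

Lemma halts_returns x t : halts_in P x t -> exists y, returns x t y.
Proof.
case: t => [[/pc_run0 //]|t] hx; exists (regs (run P t.+1 x) ord0); split=> //.
have [Ht _] := hx; have [_ _ _] := sim_run false x t.
by rewrite mul1r Ht => ->.
Qed.

Lemma returns_gt0 x t y : returns x t y -> (0 < t)%N.
Proof. by case: t => // -[[/pc_run0]]. Qed.

Definition test_const n V (i : instr 1 n V) (v : V) : int :=
  if i is IIfC _ _ k _ then k v else 0.

Definition const_bound : nat :=
  \max_(lv : 'I_(len P) * fvars P) `|test_const (code lv.1) lv.2|%N.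

Lemma cmp_eval_large s o (B z z' : int) (b : int) : `|b| <= B -> B < z -> B < z' ->
  cmp_eval o (sg s * z) b = cmp_eval o (sg s * z') b.
Proof. by move=> ? ? ?; case: o; case: s => /=; lia. Qed.

(** Comparing the register with itself has a fixed outcome, and beyond the bound a comparison with a
    constant depends on the sign only. *)
Lemma target_large l v s z z' : const_bound%:Z < z -> const_bound%:Z < z' ->
  target l v (sg s * z) = target l v (sg s * z').
Proof.
move=> ltz ltz'.
have := @leq_bigmax _ (fun lv : 'I_(len P) * fvars P =>
  `|test_const (code lv.1) lv.2|%N) (l, v).
rewrite -/const_bound /target /=; case: (code l) => //= [x o y l'|x o k l'] le_k.
  by rewrite /cmp_eval; case: o; rewrite ?ltxx ?lexx ?eqxx.
by rewrite (@cmp_eval_large s o const_bound z z') //; lia.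
Qed.

(** The sample value just above [const_bound] stands for every larger one, by [target_large]. *)
Definition control_next (q : control) : control :=
  (abs_step (q, const_bound.+1%:Z)).1.

Definition control_slope (q : control) : nat :=
  if q.1.1 is Some l then `|(effect (code l) q.1.2).1|%N else 1%N.

Definition control_offset (q : control) : int :=
  if q.1.1 is Some l then
    let: (a, b) := effect (code l) q.1.2 in sg (q.2 (+) (a < 0)) * b
  else 0.

Lemma abs_step_large q z : const_bound%:Z < z ->
  abs_step (q, z) =
    (control_next q, (control_slope q)%:Z * z + control_offset q).
Proof.
move=> ltz; case: q => [[[l|] v] s]; last first.
  by rewrite /control_next /abs_step /control_slope /control_offset /= mul1r addr0.
rewrite /control_next /abs_step /control_slope /control_offset /=.
case: (effect _ _) => a b /=.
rewrite (target_large _ _ _ ltz (z' := const_bound.+1%:Z)); last by lia.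
by rewrite mulrDr sg_flip abszE.
Qed.

Lemma control_slope_pow2 q :
  control_slope q = 0%N \/ exists m, control_slope q = (2 ^ m)%N.
Proof.
case: q => [[[l|] v] s]; rewrite /control_slope /=; last by right; exists 0%N.
by case: (code l) => *; (by left) || (right; by exists 0%N) || (right; by exists 1%N).
Qed.

Lemma returns_trichotomy s :
  exists k : nat,
    [\/ exists t m j e, forall n, (k <= n)%N ->
          returns (sg s * n%:Z) t (sg e * (2 ^+ m * n%:Z) + j),
        exists t y, forall n, (k <= n)%N -> returns (sg s * n%:Z) t y,
        forall n, (k <= n)%N -> forall t y, ~ returns (sg s * n%:Z) t y
      | exists h e : nat, [/\ (0 < h)%N, (0 < e)%N &
          forall n, (k <= n)%N -> forall t y,
            returns (sg s * (n + h)%N%:Z) t y <->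
            exists2 t', t = (t' + e)%N & returns (sg s * n%:Z) t' y]].
Proof.
have [k kP] := @large_trichotomy control halted abs_step control_next
  control_slope control_offset const_bound abs_step_large control_slope_pow2 (start s).
exists k; case: kP => [[t [m [j [q hit]]]]|[t [d hit]]|nhit|[h [e [h0 e0 hit]]]].
- constructor 1; exists t.+1, m, (sg q.2 * j), q.2 => n le_n; apply/returnsP.
  exists t, (q, (2 ^ m)%N%:Z * n%:Z + j); split=> //; first by apply: hit; rewrite lez_nat.
  by rewrite mulrDr /= -(natz (2 ^ m)) natrX.
- constructor 2; exists t.+1, (sg d.1.2 * d.2) => n le_n; apply/returnsP.
  by exists t, d; split=> //; apply: hit; rewrite lez_nat.
- constructor 3 => n le_n t y /returnsP[t' [d [_ hit _]]].
  by apply: nhit hit; rewrite lez_nat.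
constructor 4; exists h, e; split=> // n le_n t y.
have le_nz : k%:Z <= n%:Z by rewrite lez_nat.
split=> [/returnsP[t1 [d [-> ht yE]]]|[t' -> /returnsP[t1 [d [-> ht yE]]]]].
  have [t2 -> ht2] := (hit _ le_nz t1 d).1 ht.
  by exists t2.+1; rewrite ?addSn //; apply/returnsP; exists t2, d.
apply/returnsP; exists (t1 + e)%N, d; split=> //.
by apply/(hit _ le_nz); exists t1.
Qed.

End OneRegister.

(** * Computation time and shape of the two tails *)

(** Each of the finitely many arguments contributes at most one time; classical logic decides
    whether it has one. *)
Lemma functional_bounded (T : nat -> nat -> Prop) (N : nat) :
  (forall r t t', T r t -> T r t' -> t = t') ->
  exists M, forall r t, (r < N)%N -> T r t -> (t <= M)%N.
Proof.
move=> inj; elim: N => [|N [M MP]]; first by exists 0%N.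
have [[u Tu]|nT] := classic (exists u, T N u).
  exists (maxn M u) => r t; rewrite ltnS leq_eqVlt leq_max => /orP[/eqP ->|lt] Tt.
    by rewrite (inj _ _ _ Tt Tu) leqnn orbT.
  by rewrite (MP r t).
exists M => r t; rewrite ltnS leq_eqVlt => /orP[/eqP ->|lt] Tt; last exact: MP Tt.
by case: nT; exists t.
Qed.

Section PeriodicTime.

Variables (T : nat -> nat -> Prop) (k h e : nat).
Hypothesis T_inj : forall n t t', T n t -> T n t' -> t = t'.
Hypothesis T_gt0 : forall n t, T n t -> (0 < t)%N.
Hypotheses (h0 : (0 < h)%N) (e0 : (0 < e)%N).
Hypothesis T_shift : forall n, (k <= n)%N -> forall t,
  T (n + h) t -> exists2 t', t = (t' + e)%N & T n t'.

(** Write [n = k + r + q * h] with [r < h]: the time is that of [k + r], between 1 and [M], plus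
    [q * e]. *)
Lemma periodic_time_linear :
  exists M, forall n t, (k <= n)%N -> T n t ->
    (n - k < t * h)%N /\ (t <= M + n * e)%N.
Proof.
have [M MP] := @functional_bounded (fun r => T (k + r)) h (fun r => @T_inj (k + r)).
have shift q r t : T (k + r + q * h) t -> exists2 t', t = (t' + q * e)%N & T (k + r) t'.
  elim: q t => [|q IHq] t; first by exists t; rewrite ?addn0 // -[(k + r)%N]addn0.
  have -> : (k + r + q.+1 * h = k + r + q * h + h)%N by lia.
  move=> /T_shift[|t1 -> /IHq[t2 -> T2]]; first by lia.
  by exists t2 => //; lia.
exists M => n t le_kn Tt; have nE := divn_eq (n - k) h.
have r_lt : ((n - k) %% h < h)%N by rewrite ltn_mod.
have [|t' tE T'] := shift ((n - k) %/ h)%N ((n - k) %% h)%N t.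
  by rewrite -addnA [(_ %% _ + _)%N]addnC -nE subnKC.
have le_t' := MP _ _ r_lt T'; have t'0 := T_gt0 T'.
have leq : ((n - k) %/ h <= n)%N by apply: leq_trans (leq_div _ _) _; lia.
move: ((n - k) %/ h)%N ((n - k) %% h)%N nE r_lt tE leq {T'} => q r nE r_lt tE leq.
have le_qt : (q.+1 <= t)%N by nia.
have := leq_mul le_qt (leqnn h); have := leq_mul leq (leqnn e).
by split; lia.
Qed.

Lemma periodic_time_exponential : (0 < k)%N ->
  exists c d, [/\ (0 < c)%N, (0 < d)%N & forall n t, (k <= n)%N -> T n t ->
    (2 ^ ndigits 2 n <= c * t)%N /\ (t <= d * 2 ^ ndigits 2 n)%N].
Proof.
move=> k0; have [M MP] := periodic_time_linear.
(* [c] works because [2 ^ ndigits 2 n <= 2 * n] and [n < k + t * h], and [d] because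
   [n < 2 ^ ndigits 2 n]. *)
exists (2 * k * h)%N, (M + e)%N; split; [nia | lia |] => n t le_kn Tt.
have [lo hi] := MP n t le_kn Tt.
have /andP[] : (2 ^ trunc_log 2 n <= n < 2 ^ (trunc_log 2 n).+1)%N.
  by rewrite trunc_logP ?trunc_log_ltn //; lia.
rewrite /ndigits expnS; move: (2 ^ _)%N => p le_p lt_n.
by split; nia.
Qed.

End PeriodicTime.

Section Tails.

Variables (P : program 1) (f : int -> option int).
Hypotheses (hP : read_first_write_last P) (hf : computes P f).

Lemma computes_returns x y : f x = Some y <-> exists t, returns P x t y.
Proof. exact: hf. Qed.

Lemma exponential_time_of_period s k h e :
  (0 < k)%N -> (0 < h)%N -> (0 < e)%N ->
  (forall n, (k <= n)%N -> forall t y,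
     returns P (sg s * (n + h)%N%:Z) t y <->
     exists2 t', t = (t' + e)%N & returns P (sg s * n%:Z) t' y) ->
  exponential_time_or_diverges P (fun x => k%:Z <= sg s * x).
Proof.
move=> k0 h0 e0 per.
pose T n t := halts_in P (sg s * n%:Z) t.
have [||n le_n t /(halts_returns hP)[y]|c [d [c0 d0 cd]]] :=
  @periodic_time_exponential T k h e _ _ h0 e0 _ k0.
- by move=> n; apply: halts_in_inj.
- by move=> n t /(halts_returns hP)[y] /(returns_gt0 hP).
- by move=> /(per n le_n)[t' -> [ht _]]; exists t'.
exists 2, 2, (c%:R)^-1, d%:R; split.
  by split; rewrite ?ltr1n ?invr_gt0 ?ltr0n.
move=> x le_x; have [[t ht]|nh] := classic (exists t, halts_in P x t); last by right.
left; exists t; split=> //.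
have xE : sg s * `|x|%N%:Z = x.
  by case: s le_x {per T cd} => /= le_x; rewrite /sg /= ; lia.
have [||lo hi] := cd `|x|%N t; first by case: s le_x {per T cd xE} => /=; lia.
  by rewrite /T xE.
rewrite ler_pdivrMl ?ltr0n // -!natrX -!natrM !ler_nat.
by rewrite lo.
Qed.

Definition affine_tail (D : int -> Prop) (i j : int) : Prop :=
  (forall x, D x -> f x = Some (i * x + j)) /\ constant_time P D.

Definition periodic_tail (D : int -> Prop) (h : int) : Prop :=
  (forall x, D x -> f x = f (x + h)) /\
  (constant_time P D \/ exponential_time_or_diverges P D).

Definition tail_shape (D : int -> Prop) (h i j : int) : Prop :=
  periodic_tail D h \/ affine_tail D i j \/ affine_tail D (- i) j.

Lemma constant_time_sub (D D' : int -> Prop) :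
  (forall x, D' x -> D x) -> constant_time P D -> constant_time P D'.
Proof. by move=> sub [t tP]; exists t => x /sub; apply: tP. Qed.

(** This serves to give both tails a common threshold and a common period. *)
Lemma tail_shape_sub (D D' : int -> Prop) h i j n :
  (forall x, D' x -> D x) -> (forall x, D x -> D (x + h)) ->
  tail_shape D h i j -> tail_shape D' (h * n%:Z) i j.
Proof.
move=> sub shift [[per time]|[[val time]|[val time]]].
- left; split=> [x /sub Dx|].
    elim: n => [|n IHn]; first by rewrite mulr0 addr0.
    have : D (x + h * n%:Z).
      elim: n {IHn} => [|n IHn]; first by rewrite mulr0 addr0.
      by rewrite intS mulrDr mulr1 addrCA addrC; apply: shift.
    by move=> /per; rewrite IHn => ->; congr f; rewrite intS; ring.
  case: time => [time|[a [b [c [d [pos time]]]]]]; [left|right].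
    exact: constant_time_sub time.
  by exists a, b, c, d; split=> // x /sub; apply: time.
- right; left; split=> [x /sub|]; first exact: val.
  exact: constant_time_sub time.
right; right; split=> [x /sub|]; first exact: val.
exact: constant_time_sub time.
Qed.

Lemma computes_ext x x' :
  (forall y, (exists t, returns P x t y) <-> (exists t, returns P x' t y)) ->
  f x = f x'.
Proof.
move=> ext; case fx: (f x) => [y|].
  by apply/esym/computes_returns/ext/computes_returns.
by case fx': (f x') => [y|] //; move/computes_returns/ext/computes_returns: fx'; rewrite fx.
Qed.

Lemma tail_shape_exists s :
  exists k h : nat, exists m : nat, exists j : int, [/\ (0 < k)%N, (0 < h)%N &
    tail_shape (fun x => k%:Z <= sg s * x) (sg s * h%:Z) (2 ^+ m) j].
Proof.
have [k0 kP] := returns_trichotomy hP s.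
have natE k x : k%:Z <= sg s * x -> exists2 n : nat, (k <= n)%N & x = sg s * n%:Z.
  move=> le_x; exists `|x|%N; first by case: s le_x {kP} => /=; lia.
  by case: s le_x {kP}; rewrite /sg /=; lia.
exists k0.+1; case: kP => [[t [m [j [e val]]]]|[t [y val]]|none|[h [e [h0 e0 per]]]].
- exists 1%N, m, j; split=> //; right.
  have ct : constant_time P (fun x => k0.+1%:Z <= sg s * x).
    by exists t => x /natE[n /ltnW le_n ->]; have [] := val n le_n.
  (* The output has slope [sg e] times a power of 2 in [n], and [x = sg s * n]: equal signs give the
     slope [2 ^+ m] in [x], opposite ones its negative. *)
  case se: (s == e); [left|right]; split=> // x /natE[n /ltnW le_n ->];
    apply/computes_returns; exists t; have := val n le_n; congr (returns _ _ _ (_ + _)).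
  - by rewrite (eqP se); ring.
  - by case: s e se {val natE ct} => -[] //= _; ring.
- exists 1%N, 0%N, 0; split=> //; left; split.
    move=> x /natE[n /ltnW le_n ->]; rewrite -mulrDr -PoszD.
    rewrite (iffRL (computes_returns _ y)); last by exists t; apply: val.
    apply/esym/computes_returns; exists t; apply: val.
    exact: leq_trans le_n (leq_addr _ _).
  by left; exists t => x /natE[n /ltnW le_n ->]; have [] := val n le_n.
- exists 1%N, 0%N, 0; split=> //; left; split.
    move=> x /natE[n /ltnW le_n ->]; rewrite -mulrDr -PoszD; apply: computes_ext => y.
    split=> -[t ret]; first by case: (none n le_n t y).
    by case: (none (n + 1)%N (leq_trans le_n (leq_addr _ _)) t y).
  right; exists 2, 2, 1, 1; split=> // x /natE[n /ltnW le_n ->]; right.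
  by move=> [t /(halts_returns hP)[y]]; apply: none.
exists h, 0%N, 0; split=> //; left; split.
  move=> x /natE[n /ltnW le_n ->]; rewrite -mulrDr -PoszD; apply: computes_ext => y.
  split=> -[t]; last by move=> /(per n le_n)[t' _]; exists t'.
  by move=> ret; exists (t + e)%N; apply/(per n le_n); exists t.
right; apply: (@exponential_time_of_period s k0.+1 h e) => // n /ltnW le_n.
exact: per.
Qed.

End Tails.

(** * Automatic relations in base 2 *)

Definition binary_automatic (R : int -> int -> Prop) : Prop :=
  exists A : dfa (sym 0 * sym 0)%type,
    forall x y, dfa_accepts A (conv 0 x y) <-> R x y.

Lemma binary_automatic_ext (R R' : int -> int -> Prop) :
  (forall x y, R x y <-> R' x y) -> binary_automatic R -> binary_automatic R'.
Proof. by move=> ext [A AP]; exists A => x y; rewrite AP. Qed.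

(** Acceptance is specified only on words [conv 0 x y], so swapping final states needs no check of
    well-formedness. *)
Lemma binary_automatic_not (R : int -> int -> Prop) :
  binary_automatic R -> binary_automatic (fun x y => ~ R x y).
Proof.
move=> [A AP].
exists (Dfa (dstart A) (@dstep _ A) (fun q => ~~ dfinal (d := A) q)) => x y.
by rewrite -AP; split=> [/negP|/negP].
Qed.

Lemma binary_automatic_and (R R' : int -> int -> Prop) :
  binary_automatic R -> binary_automatic R' ->
  binary_automatic (fun x y => R x y /\ R' x y).
Proof.
move=> [A AP] [B BP].
exists (@Dfa _ (dstate A * dstate B)%type (dstart A, dstart B)
  (fun q a => (dstep q.1 a, dstep q.2 a)) (fun q => dfinal q.1 && dfinal q.2)) => x y.
rewrite -AP -BP /dfa_accepts /=.
have -> w p q : foldl (fun (q : dstate A * dstate B) a => (dstep q.1 a, dstep q.2 a)) (p, q) w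
    = (foldl (@dstep _ A) p w, foldl (@dstep _ B) q w).
  by elim: w p q => //= a w IHw p q; apply: IHw.
by split=> /andP.
Qed.

Lemma binary_automatic_or (R R' : int -> int -> Prop) :
  binary_automatic R -> binary_automatic R' ->
  binary_automatic (fun x y => R x y \/ R' x y).
Proof.
move=> aR aR'; have := binary_automatic_not (binary_automatic_and
  (binary_automatic_not aR) (binary_automatic_not aR')).
apply: binary_automatic_ext => x y; split; last tauto.
by move=> /not_and_or[] /NNPP; [left|right].
Qed.

Section DigitTracking.

Variables (T : finType) (track : bool -> bool -> nat -> nat -> T).
Variables (next : T -> 'I_2 -> 'I_2 -> T).
Hypothesis track_next : forall s s' m n (d e : 'I_2),
  track s s' (2 * m + d) (2 * n + e) = next (track s s' m n) d e.

(** [None] is the state before the sign pair; after it, [track] summarises the digit prefixes read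
    so far, starting with empty ones of value 0. *)
Let tstep (o : option T) (a : sym 0 * sym 0) : option T :=
  match o, a with
  | _, (inl s, inl s') => Some (track s s' 0 0)
  | Some t, (inr d, inr e) => Some (next t d e)
  | _, _ => None
  end.

(** [m %/ 2 ^ L] is the prefix of [m] before its last [L] digits; the induction on [L] reads the top
    remaining digit. *)
Lemma track_digits s s' m n L :
  foldl tstep (Some (track s s' (m %/ 2 ^ L) (n %/ 2 ^ L)))
    (zip [seq (inr (inZp (m %/ 2 ^ i)) : sym 0) | i <- rev (iota 0 L)]
         [seq (inr (inZp (n %/ 2 ^ i)) : sym 0) | i <- rev (iota 0 L)])
  = Some (track s s' m n).
Proof.
elim: L => [|L IHL]; first by rewrite /= !divn1.
have -> : rev (iota 0 L.+1) = L :: rev (iota 0 L) by rewrite -addn1 iotaD rev_cat.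
rewrite -[RHS]IHL /= -track_next; congr (foldl _ (Some (track _ _ _ _)) _);
  by rewrite /= expnSr divnMA mulnC -divn_eq.
Qed.

Lemma binary_automatic_track (fin : pred T) :
  binary_automatic (fun x y => fin (track (x < 0) (y < 0) `|x|%N `|y|%N)).
Proof.
exists (Dfa None tstep (fun o => if o is Some t then fin t else false)) => x y.
rewrite /dfa_accepts /conv /repr /=.
set L := maxn _ _.
have small (z : int) : (ndigits 2 `|z|%N <= L)%N -> (`|z| %/ 2 ^ L = 0)%N.
  move=> le_L; apply: divn_small.
  by apply: leq_trans (trunc_log_ltn `|z|%N (isT : 1 < 2)%N) _; apply: leq_pexp2l.
have := track_digits (x < 0) (y < 0) `|x|%N `|y|%N L.
by rewrite !small ?leq_maxl ?leq_maxr // => ->.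
Qed.

End DigitTracking.

Lemma sg_abs (x : int) : sg (x < 0) * `|x|%N%:Z = x.
Proof. by rewrite /sg; case: ltrP; lia. Qed.

Lemma binary_automatic_neg : binary_automatic (fun x _ => x < 0).
Proof.
exact: (@binary_automatic_track bool (fun s _ _ _ => s) (fun s _ _ => s)
  (fun _ _ _ _ _ _ => erefl) id).
Qed.

(* Reading one more digit of [x] and [y] doubles [a x + b y] and adds at most
   [|a| + |b|], so a value beyond [M] can never come back to [c]. *)
Lemma binary_automatic_linear (a b c : int) :
  binary_automatic (fun x y => a * x + b * y = c).
Proof.
pose M := (`|a| + `|b| + `|c|)%N.
(* Values between [- M] and [M] are stored shifted by [M], and [None] is an absorbing overflow; [M]
   includes [|c|] so that [clamp c] is no overflow. *)
pose clamp (v : int) : option 'I_(2 * M).+1 :=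
  if `|v| <= M%:Z then Some (inord (absz (v + M%:Z))) else None.
have clampE v i : clamp v = Some i -> `|v| <= M%:Z /\ i%:Z - M%:Z = v.
  by rewrite /clamp; case: ifP => // le_v [<-]; rewrite inordK; lia.
have digits_le s s' (d e : 'I_2) :
    `|a * (sg s * d%:Z) + b * (sg s' * e%:Z)| <= `|a| + `|b|.
  by case: d e => [[|[|//]] ?] [[|[|//]] ?] /=; case: s; case: s'; rewrite /sg /=; lia.
pose track s s' m n := (s, s', clamp (a * (sg s * m%:Z) + b * (sg s' * n%:Z))).
pose next (t : bool * bool * option 'I_(2 * M).+1) (d e : 'I_2) :=
  (t.1.1, t.1.2, if t.2 is Some i then
    clamp (2 * (i%:Z - M%:Z) + (a * (sg t.1.1 * d%:Z) + b * (sg t.1.2 * e%:Z)))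
    else None).
have track_next s s' m n (d e : 'I_2) :
    track s s' (2 * m + d)%N (2 * n + e)%N = next (track s s' m n) d e.
  rewrite /track /next /=; congr (_, _, _).
  set w := a * (sg s * d%:Z) + b * (sg s' * e%:Z).
  set v := a * (sg s * m%:Z) + b * (sg s' * n%:Z).
  have -> : a * (sg s * (2 * m + d)%N%:Z) + b * (sg s' * (2 * n + e)%N%:Z) = 2 * v + w.
    have -> : (2 * m + d)%N%:Z = 2 * m%:Z + d%:Z by lia.
    have -> : (2 * n + e)%N%:Z = 2 * n%:Z + e%:Z by lia.
    by rewrite /v /w; ring.
  case E: (clamp v) => [i|]; first by have [_ ->] := clampE _ _ E.
  have le_w := digits_le s s' d e; rewrite -/w in le_w.
  move: E; rewrite /clamp; case: ifP => // lt_v _; case: ifP => // le_vw.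
  by move: lt_v le_vw le_w; rewrite /M; lia.
have := binary_automatic_track track_next (fun t => t.2 == clamp c).
apply: binary_automatic_ext => x y; rewrite /track /= !sg_abs.
split=> [/eqP|->]; last exact: eqxx.
case E: (clamp c) => [i|]; last by move: E; rewrite /clamp ifT // /M; lia.
by move=> /clampE[_ <-]; have [_ ->] := clampE _ _ E.
Qed.

(** The digits are those of the absolute value, so its residue is tracked and the sign is applied at
    acceptance. *)
Lemma binary_automatic_mod (h : nat) (r : int) : (0 < h)%N ->
  binary_automatic (fun x _ => (h%:Z %| x - r)%Z).
Proof.
case: h => // h _.
pose track (s s' : bool) (m n : nat) : bool * 'I_h.+1 := (s, inZp m).
pose next (t : bool * 'I_h.+1) (d e : 'I_2) : bool * 'I_h.+1 := (t.1, inZp (2 * t.2 + d)).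
have track_next s s' m n (d e : 'I_2) :
    track s s' (2 * m + d)%N (2 * n + e)%N = next (track s s' m n) d e.
  by congr pair; apply: val_inj; rewrite /= -modnDml -modnMmr modnDml.
have := binary_automatic_track track_next (fun t => (h.+1%:Z %| sg t.1 * t.2%:Z - r)%Z).
apply: binary_automatic_ext => x y; rewrite /track /=.
have -> : x - r = sg (x < 0) * (`|x| %% h.+1)%N%:Z - r
    + sg (x < 0) * (`|x| %/ h.+1)%N%:Z * h.+1%:Z.
  rewrite -{1}(sg_abs x) {1}(divn_eq `|x|%N h.+1) PoszD PoszM; ring.
rewrite [X in _ <-> is_true X]rpredDr; first exact: iff_refl.
exact: dvdz_mull.
Qed.

Lemma binary_automatic_false : binary_automatic (fun _ _ => False).
Proof.
by have := binary_automatic_linear 0 0 1; apply: binary_automatic_ext => x y; split; lia.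
Qed.

Lemma binary_automatic_bigor (I : eqType) (s : seq I) (R : I -> int -> int -> Prop) :
  (forall i, binary_automatic (R i)) ->
  binary_automatic (fun x y => exists2 i, i \in s & R i x y).
Proof.
move=> aR; elim: s => [|i s IHs].
  by apply: binary_automatic_ext binary_automatic_false => x y; split=> // -[].
apply: binary_automatic_ext (binary_automatic_or (aR i) IHs) => x y; split.
  move=> [Rxy|[j js Rxy]]; first by exists i; rewrite ?mem_head.
  by exists j; rewrite // inE js orbT.
by move=> [j]; rewrite inE => /orP[/eqP ->|js] Rxy; [left|right; exists j].
Qed.

Lemma binary_automatic_value (o : option int) : binary_automatic (fun _ y => o = Some y).
Proof.
case: o => [v|].
  apply: binary_automatic_ext (binary_automatic_linear 0 1 v) => x y.
  by rewrite mul0r add0r mul1r; split=> [->|[->]].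
by apply: binary_automatic_ext binary_automatic_false.
Qed.

Lemma binary_automatic_near0 (R : int -> int -> Prop) (k : nat) :
  (forall c, binary_automatic (fun _ y => R c y)) ->
  binary_automatic (fun x y => `|x| < k%:Z /\ R x y).
Proof.
(* [pt] enumerates the integers strictly between [- k] and [k]. *)
move=> aR; pose pt (i : nat) : int := i.+1%:Z - k%:Z.
have := @binary_automatic_bigor _ (iota 0 (2 * k).-1)
  (fun i x y => 1 * x + 0 * y = pt i /\ R (pt i) y).
move=> /(_ (fun i => binary_automatic_and (binary_automatic_linear _ _ _) (aR _))).
apply: binary_automatic_ext => x y; split.
  move=> [i]; rewrite mem_iota mul1r mul0r addr0 => lt_i [-> Ri]; split=> //.
  by rewrite /pt; lia.
move=> [lt_x Rx]; exists (absz (x + k%:Z - 1)%R); first by rewrite mem_iota; lia.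
have -> : pt (absz (x + k%:Z - 1)%R) = x by rewrite /pt; lia.
by rewrite mul1r mul0r addr0.
Qed.

(** For positive [k] the ray is cut out by a sign and the complement of a bounded interval, so no
    automaton has to compare magnitudes. *)
Lemma binary_automatic_ray s (k : nat) : (0 < k)%N ->
  binary_automatic (fun x _ => k%:Z <= sg s * x).
Proof.
move=> k0.
have small := binary_automatic_near0 k (fun _ =>
  binary_automatic_not binary_automatic_false).
have sign : binary_automatic (fun x _ => (x < 0) = s).
  case: s; first exact: binary_automatic_neg.
  apply: binary_automatic_ext (binary_automatic_not binary_automatic_neg) => x y.
  by split=> [/negP/negbTE|->].
apply: binary_automatic_ext (binary_automatic_and sign (binary_automatic_not small)) => x y.
split=> [[sx nx]|le_x].
  have {}nx : ~ `|x| < k%:Z by move=> lt_x; apply: nx; split=> // -[].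
  by move: sx; case: s {sign}; rewrite /sg /=; lia.
split=> [|[lt_x _]]; move: le_x; case: s {sign}; rewrite /sg /=; lia.
Qed.

Lemma binary_automatic_tail (P : program 1) (f : int -> option int) s (k h : nat) i j :
  (0 < k)%N -> (0 < h)%N ->
  tail_shape P f (fun x => k%:Z <= sg s * x) (sg s * h%:Z) i j ->
  binary_automatic (fun x y => k%:Z <= sg s * x /\ f x = Some y).
Proof.
move=> k0 h0 shape.
have aff a b : (forall x, k%:Z <= sg s * x -> f x = Some (a * x + b)) ->
    binary_automatic (fun x y => k%:Z <= sg s * x /\ f x = Some y).
  move=> fE; apply: binary_automatic_ext (binary_automatic_and
    (binary_automatic_ray s k0) (binary_automatic_linear (- a) 1 b)) => x y.
  split=> -[le_x]; rewrite fE // => E; split=> //.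
    by rewrite -E; congr Some; ring.
  by case: E => <-; ring.
case: shape => [[per _]|[[/aff]|[/aff]]] //.
(* The points [pt r] with [r < h] represent the residue classes on the ray; the graph is a finite
   union over them. *)
pose pt (r : nat) : int := sg s * (k + r)%N%:Z.
have perM q r : f (sg s * (k + r + q * h)%N%:Z) = f (pt r).
  elim: q => [|q IHq]; first by rewrite addn0.
  rewrite -{}IHq mulSn addnCA PoszD mulrDr addrC -per //.
  by rewrite sgK; lia.
have ptP n r : (k <= n)%N -> (r < h)%N -> (h%:Z %| sg s * n%:Z - pt r)%Z ->
    f (sg s * n%:Z) = f (pt r).
  move=> le_n lt_r; rewrite /pt -mulrBr dvdzE abszM.
  have -> : `|sg s|%N = 1%N by case: (s).
  rewrite mul1n => /dvdnP[q qE]; rewrite -(perM q); congr (f (_ * Posz _)).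
  (* Divisibility gives the distance [q * h] between [n] and [k + r]; [n] cannot be the smaller one
     with [q > 0], since [k <= n] and [r < h]. *)
  by case: q qE => [|q]; rewrite ?mulSn; nia.
have := @binary_automatic_bigor _ (iota 0 h)
  (fun r x y => (h%:Z %| x - pt r)%Z /\ f (pt r) = Some y).
move=> /(_ (fun r => binary_automatic_and (binary_automatic_mod _ h0)
  (binary_automatic_value _))) aper.
apply: binary_automatic_ext
  (binary_automatic_and (binary_automatic_ray s k0) aper) => x y.
split=> -[le_x];
  have xE : x = sg s * `|x|%N%:Z by
    move: le_x; case: (s); rewrite /sg /=; lia.
  move=> [r]; rewrite mem_iota => lt_r [dv fr]; split=> //; rewrite xE (ptP _ r) -?xE //.
  by rewrite xE sgK in le_x.
move=> fx; split=> //; have le_n : (k <= `|x|)%N by rewrite xE sgK in le_x.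
exists ((`|x| - k) %% h)%N; first by rewrite mem_iota ltn_mod.
have dv : (h%:Z %| x - pt ((`|x| - k) %% h)%N)%Z.
  rewrite {1}xE -mulrBr dvdz_mull //; apply/dvdzP; exists ((`|x| - k) %/ h)%N%:Z.
  by have := divn_eq (`|x| - k) h; lia.
by split=> //; rewrite -fx {2}xE; apply/esym/ptP; rewrite -?xE ?ltn_mod.
Qed.

(** * Gluing the two tails and the arguments near 0 *)

Theorem theorem17 (P : program 1) (f : int -> option int)
    (hP : read_first_write_last P) (hf : computes P f) :
  automatic f /\
  exists k h i j i' j' : int,
    [/\ 0 < k, 0 < h, power_of_2 i & power_of_2 i'] /\
    ( (forall x, k <= x -> f x = f (x + h)) /\
        (constant_time P (fun x => k <= x) \/
         exponential_time_or_diverges P (fun x => k <= x))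
      \/
      (forall x, k <= x -> f x = Some (i * x + j)) /\
        constant_time P (fun x => k <= x)
      \/
      (forall x, k <= x -> f x = Some (- i * x + j)) /\
        constant_time P (fun x => k <= x) ) /\
    ( (forall x, x <= - k -> f x = f (x - h)) /\
        (constant_time P (fun x => x <= - k) \/
         exponential_time_or_diverges P (fun x => x <= - k))
      \/
      (forall x, x <= - k -> f x = Some (i' * x + j')) /\
        constant_time P (fun x => x <= - k)
      \/
      (forall x, x <= - k -> f x = Some (- i' * x + j')) /\
        constant_time P (fun x => x <= - k) ).
Proof.
have [k1 [h1 [m1 [j1 [k1_gt0 h1_gt0 shape1]]]]] := tail_shape_exists hP hf false.
have [k2 [h2 [m2 [j2 [k2_gt0 h2_gt0 shape2]]]]] := tail_shape_exists hP hf true.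
(* The sum exceeds both thresholds, and [h1 * h2] will be the common period. *)
pose k := (k1 + k2)%N.
have aut1 := binary_automatic_tail k1_gt0 h1_gt0 shape1.
have aut2 := binary_automatic_tail k2_gt0 h2_gt0 shape2.
have {}shape1 : tail_shape P f (fun x => k%:Z <= x) (h1 * h2)%N (2 ^+ m1) j1.
  have -> : (h1 * h2)%N%:Z = sg false * h1%:Z * h2%:Z by rewrite mul1r PoszM.
  by apply: tail_shape_sub shape1; rewrite /k /sg => x; lia.
have {}shape2 : tail_shape P f (fun x => x <= - k%:Z) (- (h1 * h2)%N%:Z) (2 ^+ m2) j2.
  have -> : - (h1 * h2)%N%:Z = sg true * h2%:Z * h1%:Z by rewrite mulN1r PoszM; ring.
  by apply: tail_shape_sub shape2; rewrite /k /sg => x; lia.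
split; last first.
  exists k%:Z, (h1 * h2)%N%:Z, (2 ^+ m1), j1, (2 ^+ m2), j2; split; last by split.
  by split; [rewrite /k; lia | nia | exists m1 | exists m2].
(* The bounded range overlaps the two rays harmlessly, since every piece asserts [f x = Some y]. *)
have near0 := binary_automatic_near0 k (fun c => binary_automatic_value (f c)).
have aut := binary_automatic_or near0 (binary_automatic_or aut1 aut2).
have [|A AP] := binary_automatic_ext (R' := fun x y => f x = Some y) _ aut;
  last by exists 0%N, A.
move=> x y; split=> [[[]|[[]|[]]] //|fx].
case: (ltrP `|x| k%:Z) => le_x; first by left.
right; case: (ltrP x 0) => x0; [right|left]; split=> //;
  by move: le_x; rewrite /sg /k /=; lia.
Qed.
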